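(* There exist absolute constants $\beta\ge1$ and $c>0$ such that every weighted graph $G=(V,E,w)$ with treewidth $\mathrm{tw}$ admits a strong $(\beta,s)$-padded partition cover scheme with $s=O(\mathrm{tw}^c)$ (i.e. $s=\mathrm{poly}(\mathrm{tw})$). That is, for every $\Delta>0$ there are partitions $\mathcal{P}_1,\dots,\mathcal{P}_\tau$ of $V$ with $\tau\le s$ such that every cluster $C$ of every $\mathcal{P}_i$ satisfies $\max_{u,v\in C}d_{G[C]}(u,v)\le\Delta$, and for every $x\in V$ there is an index $i$ and a cluster $C\in\mathcal{P}_i$ with $B_G(x,\Delta/\beta)\subseteq C$.
   Context: $G=(V,E,w)$ is a connected undirected graph with nonnegative edge weights; $d_G$ is its shortest-path metric, $G[C]$ the induced subgraph on $C$ with shortest-path metric $d_{G[C]}$, and $B_G(x,r)=\{u\in V:d_G(x,u)\le r\}$. *)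

(* Defs.v *)
From HB Require Import structures.
From mathcomp Require Import all_boot all_order all_algebra.
From mathcomp Require Import boolp classical_sets reals ereal exp.
Set Implicit Arguments. Unset Strict Implicit. Unset Printing Implicit Defensive.
Import Order.TTheory GRing.Theory Num.Theory.

Definition wgraph (R : realType) (V : finType) (e : rel V) (w : V -> V -> R) :=
  [/\ irreflexive e, symmetric e,
      (forall u v, e u v -> w u v = w v u) &
      (forall u v, e u v -> (0 <= w u v)%R)].

Definition gconnected (V : finType) (e : rel V) := forall u v : V, connect e u v.

Definition walk_len (R : realType) (V : finType) (w : V -> V -> R) (u : V) (p : seq V) : R :=
  (\sum_(x <- pairmap w u p) x)%R.

Definition walk_in (V : finType) (e : rel V) (C : {set V}) (u v : V) (p : seq V) :=
  [&& path e u p, last u p == v & all (fun x => x \in C) (u :: p)].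

(* Shortest-path metric of G[C] (value +oo when u, v are not connected in G[C]). *)
Definition dist_in (R : realType) (V : finType) (e : rel V) (w : V -> V -> R)
  (C : {set V}) (u v : V) : \bar R :=
  ereal_inf (fun r : \bar R => exists2 p, walk_in e C u v p & r = (walk_len w u p)%:E).

Definition dist (R : realType) (V : finType) (e : rel V) (w : V -> V -> R) (u v : V) : \bar R :=
  dist_in e w [set: V] u v.

Definition ball_G (R : realType) (V : finType) (e : rel V) (w : V -> V -> R) (x : V) (r : R)
  : {set V} := [set u | (dist e w x u <= r%:E)%E].

Definition is_tree (I : finType) (T : rel I) :=
  [/\ 0 < #|I|, irreflexive T, symmetric T, (forall i j, connect T i j) &
      #|[set q : I * I | T q.1 q.2]| = 2 * (#|I| - 1)].

Definition is_tree_decomposition (V : finType) (e : rel V)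
  (I : finType) (T : rel I) (B : I -> {set V}) :=
  [/\ is_tree T,
      (forall v, exists i, v \in B i),
      (forall u v, e u v -> exists i, (u \in B i) && (v \in B i)) &
      (forall v i j, v \in B i -> v \in B j ->
         connect [rel a b | [&& T a b, v \in B a & v \in B b]] i j)].

Definition has_td_of_width (V : finType) (e : rel V) (k : nat) :=
  exists (I : finType) (T : rel I) (B : I -> {set V}),
    is_tree_decomposition e T B /\ (\max_(i : I) #|B i|).-1 = k.

Definition is_treewidth (V : finType) (e : rel V) (tw : nat) :=
  has_td_of_width e tw /\ forall k, has_td_of_width e k -> tw <= k.

(* Main.v *)
Require Import Defs.
From HB Require Import structures.
From mathcomp Require Import all_boot all_order all_algebra.
From mathcomp Require Import boolp classical_sets reals ereal exp.
From mathcomp Require Import ring lra zify.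
Import Order.TTheory GRing.Theory Num.Theory.
Set Implicit Arguments. Unset Strict Implicit. Unset Printing Implicit Defensive.

(* Root the tree decomposition and walk down from the root, keeping at every bag a stack
   of cores. At a new bag [i], keep the longest prefix of the parent's stack all of whose
   cores still meet the bag, and push the core [K i]: the ball of radius [delta] around
   the bag in the graph [D i] induced on the vertices of the bags at or below [i] that
   avoid the kept cores. Cores on a stack are disjoint and all but the top one meet the
   bag, so the height [lev i] of the kept prefix is at most the bag size.

   The clusters are the balls of radius [rho], at most [2 delta], in the graphs [D i],
   centered at the vertices of bag [i]. A ball [Q] of [G] is padded: at its highest bag,
   take the lowest core on the stack that meets [Q]; then [Q] avoids all cores below it,
   so [Q] lies in the corresponding [D i] and close to bag [i].

   A vertex [z] lies in few cores of bags above it, because the levels of these bags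
   strictly decrease going down: popping a core that still meets the bag requires a new
   core at a lower level, which would swallow [z]. A bag [t] at distance in
   (delta, 2 delta] from [v] is charged to a vertex [z] of [K t] in one of boundedly many
   bags. So each vertex is in polynomially many clusters, and since a cluster meeting the
   cluster of a deeper center contains a vertex of the top bag of that center, greedy
   coloring from the top splits the clusters into polynomially many disjoint families. *)

(** * Greedy coloring *)

Lemma greedy_coloring (V : finType) (adj : rel V) (f : V -> nat) (D : nat) :
  symmetric adj ->
  (forall y, #|[set x | [&& x != y, adj x y & f x <= f y]]| <= D) ->
  exists col : V -> 'I_D.+1, forall x y, x != y -> adj x y -> col x != col y.
Proof.
move=> sym hD.
suff H (n : nat) (A : {set V}) : #|A| <= n ->
    exists col : V -> 'I_D.+1,
      forall x y, x \in A -> y \in A -> x != y -> adj x y -> col x != col y.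
  have [col hcol] := H _ [set: V]%SET (leqnn _).
  by exists col => x y; apply: hcol; rewrite inE.
elim: n A => [|n IH] A.
  rewrite leqn0 cards_eq0 => /eqP ->.
  by exists (fun=> ord0) => x y; rewrite inE.
move=> hA; have [->|[y0 y0A]] := finset.set_0Vmem A.
  by exists (fun=> ord0) => x y; rewrite inE.
(* For a vertex of maximal [f], all neighbors in [A] are counted by [D], so it can be colored
   last. *)
case: (arg_maxnP f y0A) => y /= yA ymax; have {}yA : y \in A by [].
have [|col hcol] := IH (A :\ y)%SET.
  by move: hA; rewrite (finset.cardsD1 y A) yA.
pose N := [set x | [&& x != y, adj x y & f x <= f y]]%SET.
have [c hc] : exists c, c \notin [set col x | x in N]%SET.
  apply/existsP; rewrite -negb_forall; apply/negP => /forallP h.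
  have : #|'I_D.+1| <= #|[set col x | x in N]%SET|.
    by apply/subset_leq_card/fintype.subsetP => c _; apply: h.
  by rewrite card_ord leqNgt ltnS (leq_trans (leq_imset_card _ _) (hD y)).
have hN x : x \in A -> x != y -> adj x y -> col x != c.
  move=> xA xy axy; apply: contraNneq hc => <-.
  by apply: imset_f; rewrite inE xy axy; apply: ymax.
exists (fun x => if x == y then c else col x) => x z xA zA xz axz.
have [xy|xy] := eqVneq x y; have [zy|zy] := eqVneq z y.
- by rewrite xy zy eqxx in xz.
- by rewrite eq_sym hN // sym -xy.
- by rewrite hN // -zy.
- by apply: hcol => //; rewrite !inE ?xy ?zy.
Qed.

(** * Walks of bounded length in induced subgraphs *)

Section Walks.
Variables (R : realType) (V : finType) (e : rel V) (w : V -> V -> R).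
Hypothesis e_sym : symmetric e.
Hypothesis w_sym : forall u v, e u v -> w u v = w v u.
Hypothesis w_ge0 : forall u v, e u v -> (0 <= w u v)%R.

Implicit Types (C : {set V}) (x y z u v : V) (p : seq V) (d : R).

(** An explicit walk, unlike a bound on the infimum [dist_in], can be cut and concatenated. *)
Definition reach C x d u := exists2 p, walk_in e C x u p & (walk_len w x p <= d)%R.

Lemma walk_in_cons C x u y p :
  walk_in e C x u (y :: p) = [&& e x y, x \in C & walk_in e C y u p].
Proof. by rewrite /walk_in /=; case: (e x y); case: (x \in C); rewrite /= ?andbF. Qed.

Lemma walk_in_nil C x u : walk_in e C x u [::] = (x == u) && (x \in C).
Proof. by rewrite /walk_in /= andbT. Qed.

Lemma walk_len_cons x y p : walk_len w x (y :: p) = (w x y + walk_len w y p)%R.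
Proof. by rewrite /walk_len /= big_cons. Qed.

Lemma walk_len_nil x : walk_len w x [::] = 0%R.
Proof. by rewrite /walk_len /= big_nil. Qed.

Lemma walk_len_ge0 C x u p : walk_in e C x u p -> (0 <= walk_len w x p)%R.
Proof.
elim: p x => [|y p IH] x; first by rewrite walk_len_nil.
by rewrite walk_in_cons walk_len_cons => /and3P[/w_ge0 h _ /IH]; apply: addr_ge0.
Qed.

Lemma reach_ge0 C x d u : reach C x d u -> (0 <= d)%R.
Proof. by case=> p /walk_len_ge0; apply: le_trans. Qed.

Lemma reach_refl C x d : x \in C -> (0 <= d)%R -> reach C x d x.
Proof. by move=> xC d0; exists [::]; rewrite ?walk_in_nil ?eqxx ?walk_len_nil. Qed.

Lemma reach_l C x d u : reach C x d u -> x \in C.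
Proof. by case=> p /and3P[_ _ /=/andP[]]. Qed.

Lemma reach_r C x d u : reach C x d u -> u \in C.
Proof. by case=> p /and3P[_ /eqP <- /allP h] _; apply: h; apply: mem_last. Qed.

Lemma reach_step C x y d1 d2 u :
  e x y -> x \in C -> (w x y <= d1)%R -> reach C y d2 u -> reach C x (d1 + d2)%R u.
Proof.
move=> exy xC h1 [p hp hl]; exists (y :: p); first by rewrite walk_in_cons exy xC.
by rewrite walk_len_cons; apply: lerD.
Qed.

Lemma reach_trans C x d1 y d2 u :
  reach C x d1 y -> reach C y d2 u -> reach C x (d1 + d2)%R u.
Proof.
move=> [p hp hl] hr; elim: p x d1 hp hl => [|z p IH] x d1.
  rewrite walk_in_nil walk_len_nil => /andP[/eqP -> _] d0.
  by case: hr => p hp hl; exists p => //; rewrite (le_trans hl) // lerDr.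
rewrite walk_in_cons walk_len_cons => /and3P[exz xC hp] hl.
have -> : (d1 + d2 = w x z + ((d1 - w x z) + d2))%R by rewrite addrA subrKC.
by apply: reach_step exz xC _ _ => //; apply: IH hp _; rewrite lerBrDl.
Qed.

Lemma reach_sym C x d u : reach C x d u -> reach C u d x.
Proof.
case=> p; elim: p x d => [|z p IH] x d.
  rewrite walk_in_nil walk_len_nil => /andP[/eqP -> uC] d0.
  exact: reach_refl.
rewrite walk_in_cons walk_len_cons => /and3P[exz xC hp] hl.
have -> : d = ((d - w x z) + (w x z + 0))%R by rewrite addr0 subrK.
apply: reach_trans (IH _ _ hp _) _; first by rewrite lerBrDl.
have zC : z \in C by case/and3P: hp => _ _ /andP[].
by apply: reach_step _ zC _ (reach_refl xC (lexx _)); rewrite 1?e_sym // w_sym // e_sym.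
Qed.

Lemma reach_sub C C' x d d' u :
  C \subset C' -> (d <= d')%R -> reach C x d u -> reach C' x d' u.
Proof.
move=> /fintype.subsetP sC hd [p /and3P[h1 h2 /allP h3] hl]; exists p; last exact: le_trans hd.
by apply/and3P; split=> //; apply/allP => a /h3; apply: sC.
Qed.

(* Every vertex of a walk starting at [x] is itself reached within the length of
   the walk, so a ball is connected inside itself. *)
Lemma reach_inside C C' x d u :
  reach C x d u -> (forall z, reach C x d z -> z \in C') -> reach C' x d u.
Proof.
case=> p hp hl hC'; exists p => //; case/and3P: (hp) => h1 h2 /allP h3.
apply/and3P; split=> //; apply/allP => z zp; apply: hC'.
have xC : x \in C by apply: h3; rewrite mem_head.
move: zp hp hl {h1 h2 h3}; elim: p x d xC => [|y p IH] x d xC.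
  by rewrite inE => /eqP -> _; rewrite walk_len_nil; apply: reach_refl.
rewrite inE walk_in_cons walk_len_cons => /predU1P[-> | zp] /and3P[exy _ hp] hl.
  apply: reach_refl => //; apply: le_trans hl.
  by rewrite addr_ge0 ?w_ge0 // (walk_len_ge0 hp).
have -> : d = (w x y + (d - w x y))%R by rewrite subrKC.
apply: reach_step exy xC (lexx _) _; apply: IH => //; last by rewrite lerBrDl.
by case/and3P: hp => _ _ /andP[].
Qed.

(** [y] minimizes [f] on the walk, and the part of the walk from [y] to [u] is kept. With the depth
    of top bags as [f], this finds a cluster center. *)
Lemma reach_argmin (f : V -> nat) C x d u : reach C x d u ->
  exists y, [/\ f y <= f x, f y <= f u & reach [set a in C | f y <= f a] y d u].
Proof.
case=> p hp hl.
have [y [/allP hy hr]] : exists y, all (fun a => f y <= f a) (x :: p) /\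
    reach [set a in C | f y <= f a]%SET y d u.
  elim: p x d hp hl => [|y p IH] x d.
    rewrite walk_in_nil walk_len_nil => /andP[/eqP -> uC] d0.
    exists u; rewrite /= leqnn; split=> //.
    by apply: reach_refl => //; rewrite inE uC leqnn.
  rewrite walk_in_cons walk_len_cons => /and3P[exy xC hp] hl.
  have hl' : (walk_len w y p <= d - w x y)%R by rewrite lerBrDl.
  have [z [hz hr]] := IH _ _ hp hl'.
  have [hxz|hzx] := leqP (f x) (f z).
    exists x; have hx : all (fun a => f x <= f a) [:: x, y & p].
      apply/allP => a; rewrite inE => /predU1P[-> //|/(allP hz)]; exact: leq_trans.
    split=> //; exists (y :: p); last by rewrite walk_len_cons.
    have hp' : walk_in e C x u (y :: p) by rewrite walk_in_cons exy xC.
    case/and3P: hp' => h1 h2 /allP h3; apply/and3P; split=> //.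
    by apply/allP => a ha; rewrite inE h3 //; move/allP: hx => ->.
  exists z; split; first by rewrite /= (ltnW hzx).
  apply: reach_sub hr => //; rewrite gerBl; exact: w_ge0.
exists y; split=> //; first by apply: hy; rewrite mem_head.
by apply: hy; case/and3P: hp => _ /eqP <- _; apply: mem_last.
Qed.

(* Last passage: if the edges enter [L] only through [S], a walk ending in [L] that
   does not start in [L :\: S] has a last vertex in [S] after which it stays in [L]. *)
Lemma reach_last_passage (L S : {set V}) C x d u :
  (forall a b, e a b -> b \in L :\: S -> a \in L) ->
  u \in L -> x \notin L :\: S -> reach C x d u ->
  exists z d1, [/\ z \in S, reach C x d1 z & reach (C :&: L) z (d - d1)%R u].
Proof.
move=> hLS uL xL [p hp hl].
suff : (exists z d1, [/\ z \in S, reach C x d1 z & reach (C :&: L) z (d - d1)%R u])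
    \/ all (fun a => a \in L :\: S) (x :: p).
  by case=> //; rewrite /= (negPf xL).
elim: p x d hp hl {xL} => [|y p IH] x d.
  rewrite walk_in_nil walk_len_nil => /andP[/eqP -> uC] d0.
  have [uS|uS] := boolP (u \in S); last by right; rewrite /= inE uS uL.
  left; exists u, 0%R; split=> //; first exact: reach_refl.
  by apply: reach_refl; rewrite ?inE ?uC // subr0.
rewrite walk_in_cons walk_len_cons => /and3P[exy xC hp] hl.
have hl' : (walk_len w y p <= d - w x y)%R by rewrite lerBrDl.
case: (IH _ _ hp hl') => [[z [d1 [zS h1 h2]]]|hall].
  left; exists z, (w x y + d1)%R; split=> //; first exact: reach_step exy xC (lexx _) h1.
  by rewrite opprD addrA.
have xL : x \in L by apply: hLS exy _; case/andP: hall.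
have [xS|xS] := boolP (x \in S); last by right; rewrite /= inE xS xL.
left; exists x, 0%R; split=> //; first exact: reach_refl.
exists (y :: p); last by rewrite walk_len_cons subr0.
case/and3P: hp => h1 h2 /allP h3; apply/and3P; split=> //; first by rewrite /= exy.
apply/allP => a; rewrite inE => /predU1P[->|ap]; first by rewrite inE xC xL.
by rewrite inE h3 //; have := allP hall a ap; rewrite inE => /andP[].
Qed.

End Walks.

(** * The ancestor order of a rooted tree *)

Section RootedTree.
Variables (I : finType) (root : I) (par : I -> I) (dep : I -> nat).
Hypothesis par_root : par root = root.
Hypothesis dep_par : forall i, i != root -> dep i = (dep (par i)).+1.

(* [below i a]: [i] is a descendant of [a], or [a] itself. *)
Definition below i a := fconnect par i a.
Definition sbelow i a := below i a && (i != a).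

Lemma belowP i a : reflect (exists n, iter n par i = a) (below i a).
Proof.
apply: (iffP idP) => [/iter_findex|[n <-]]; last exact: fconnect_iter.
by exists (findex par i a).
Qed.

Lemma below_refl i : below i i.
Proof. exact: connect0. Qed.

Lemma below_trans j i k : below i j -> below j k -> below i k.
Proof. exact: connect_trans. Qed.

Lemma below_par i : below i (par i).
Proof. exact: fconnect1. Qed.

Lemma below_inv i a : below i a -> i = a \/ below (par i) a.
Proof.
case/belowP=> -[<-|n]; first by left.
by rewrite iterSr => h; right; apply/belowP; exists n.
Qed.

Lemma below_total c i j : below c i -> below c j -> below i j \/ below j i.
Proof.
move=> /belowP[n <-] /belowP[m <-].
have [le_nm|/ltnW le_mn] := leqP n m; [left|right]; apply/belowP.
  by exists (m - n); rewrite -iterD subnK.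
by exists (n - m); rewrite -iterD subnK.
Qed.

Lemma below_dep i a : below i a -> dep a <= dep i.
Proof.
case/belowP=> n <-; elim: n i => //= n IH i.
apply: leq_trans (IH i); have [->|h] := eqVneq (iter n par i) root.
  by rewrite par_root.
by rewrite (dep_par h).
Qed.

Lemma sbelow_root i a : sbelow i a -> i != root.
Proof.
case/andP=> /belowP[n <-]; apply: contraNneq => ->.
by rewrite iter_fix.
Qed.

Lemma sbelow_par i a : sbelow i a -> below (par i) a.
Proof. by case/andP=> /below_inv[->|//]; rewrite eqxx. Qed.

Lemma sbelow_dep i a : sbelow i a -> dep a < dep i.
Proof. by move=> h; rewrite (dep_par (sbelow_root h)) ltnS below_dep ?sbelow_par. Qed.

Lemma below_anti i a : below i a -> below a i -> i = a.
Proof.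
move=> h1 h2; apply/eqP; apply: contraT => ia.
have : dep a < dep i by apply: sbelow_dep; rewrite /sbelow h1.
by rewrite ltnNge below_dep.
Qed.

Lemma sbelowNbelow i a : sbelow i a -> below a i -> False.
Proof. by case/andP=> h1 /eqP h2 h3; apply: h2; apply: below_anti. Qed.

Lemma below_comparable c i j :
  below c i -> below c j -> dep i <= dep j -> below j i.
Proof.
move=> ci cj dij; case: (below_total ci cj) => // ij.
have [->|h] := eqVneq i j; first exact: below_refl.
by have := @sbelow_dep i j; rewrite /sbelow ij h ltnNge dij => /(_ isT).
Qed.

(** Induction down the path from [a]; the base case is a child of [a]. *)
Lemma sbelow_ind a (P : I -> Prop) :
  (forall i, sbelow i a -> par i = a \/ sbelow (par i) a /\ P (par i) -> P i) ->
  forall i, sbelow i a -> P i.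
Proof.
move=> step i; have [n] := ubnP (dep i); elim: n i => // n IH i hn hi.
apply: step => //; have [->|h] := eqVneq (par i) a; [by left|right].
have hp : sbelow (par i) a by rewrite /sbelow h sbelow_par.
split=> //; apply: IH => //.
by move: hn; rewrite (dep_par (sbelow_root hi)).
Qed.

End RootedTree.

Lemma size_touching_disjoint (V : finType) (s : seq {set V}) (Y : {set V}) :
  pairwise (fun A A' : {set V} => [disjoint A & A']) s ->
  {in s, forall A : {set V}, ~~ [disjoint A & Y]} -> size s <= #|Y|.
Proof.
elim: s Y => //= A s IH Y /andP[/allP hA hs] ht.
have : ~~ [disjoint A & Y] by apply: ht; rewrite mem_head.
rewrite -setI_eq0 => /set0Pn[x /setIP[xA xY]].
(* Removing [A] costs [Y] a point, while the other sets, being disjoint from [A], still meet the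
   rest. *)
apply: leq_ltn_trans (IH (Y :\: A)%SET hs _) _.
  move=> A' A's; have : ~~ [disjoint A' & Y] by apply: ht; rewrite inE A's orbT.
  rewrite -!setI_eq0 => /set0Pn[z /setIP[zA' zY]].
  apply/set0Pn; exists z; rewrite !inE zA' zY !andbT.
  by apply/negP => zA; have := hA _ A's; rewrite disjoint_sym => /disjointFr/(_ zA'); rewrite zA.
apply: proper_card; apply/properP; split; first exact: subsetDl.
by exists x; rewrite // !inE xA.
Qed.

Lemma card_bigcup_le (I T : finType) (A : {set I}) (F : I -> {set T}) (m : nat) :
  (forall i, i \in A -> #|F i| <= m) -> #|\bigcup_(i in A) F i| <= #|A| * m.
Proof.
move=> hF; rewrite -sum_nat_const.
elim/big_ind2: _ => // [|a b n p ha hb]; first by rewrite cards0.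
by apply: leq_trans (leq_card_setU _ _) (leq_add ha hb).
Qed.

(** * Cores and stacks over a rooted tree decomposition *)

Section Clusters.
Variables (R : realType) (V : finType) (e : rel V) (w : V -> V -> R).
Hypothesis e_sym : symmetric e.
Hypothesis w_sym : forall u v, e u v -> w u v = w v u.
Hypothesis w_ge0 : forall u v, e u v -> (0 <= w u v)%R.
Variables (I : finType) (root : I) (par : I -> I) (dep : I -> nat).
Hypothesis par_root : par root = root.
Hypothesis dep_root : dep root = 0.
Hypothesis dep_par : forall i, i != root -> dep i = (dep (par i)).+1.
Variables (B : I -> {set V}) (top : V -> I).
Hypothesis top_in : forall v, v \in B (top v).
Hypothesis bag_below_top : forall v c, v \in B c -> below par c (top v).
Hypothesis bag_convex : forall v c i,
  v \in B c -> below par c i -> below par i (top v) -> v \in B i.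
Hypothesis bag_edge : forall u v, e u v -> exists i, (u \in B i) && (v \in B i).
(** The radii of the cores, of the clusters and of the balls to be padded. *)
Variables (delta rho r : R).
Hypothesis delta_ge0 : (0 <= delta)%R.
Hypothesis rho_le : (rho <= delta + delta)%R.
Variable k : nat.
Hypothesis card_bag : forall i, #|B i| <= k.

Local Notation below := (below par).
Local Notation sbelow := (sbelow par).
Local Notation reach := (reach e w).
Implicit Types (i j s t a c : I) (u v x y z : V) (A C X Y : {set V}).

(* The vertices of the bags at or below [i]. *)
Definition hull i := [set v | below (top v) i || (v \in B i)]%SET.

Lemma mem_hull v c i : v \in B c -> below c i -> v \in hull i.
Proof.
move=> vc ci; rewrite inE.
case: (below_total ci (bag_below_top vc)) => [it|->//].
by rewrite (bag_convex vc ci it) orbT.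
Qed.

Lemma hull_mono i j : below i j -> hull i \subset hull j.
Proof.
move=> ij; apply/fintype.subsetP => v; rewrite inE => /orP[vi|vi].
  by rewrite inE (below_trans vi ij).
exact: mem_hull vi ij.
Qed.

Lemma notin_deep_hull x a s : x \in B a -> below s a -> x \notin hull s :\: B s.
Proof.
move=> xa sa; rewrite !inE; apply/negP => /andP[/negP xs /orP[h|//]].
have as_ : below a s := below_trans (bag_below_top xa) h.
by apply: xs; rewrite (below_anti par_root dep_par sa as_).
Qed.

(** [B s] separates the deeper vertices of [hull s] from the rest: every bag containing [y] lies
    below [s], in particular the one shared with [x]. *)
Lemma edge_deep_hull s x y : e x y -> y \in hull s :\: B s -> x \in hull s.
Proof.
move=> /bag_edge[c /andP[xc yc]]; rewrite !inE => /andP[/negP ys /orP[h|//]].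
have := mem_hull xc (below_trans (bag_below_top yc) h).
by rewrite inE.
Qed.

Lemma reach_through_bag C x d u a s :
  x \in B a -> below s a -> u \in hull s -> reach C x d u ->
  exists z d1, [/\ z \in B s, reach C x d1 z & reach (C :&: hull s)%SET z (d - d1)%R u].
Proof.
move=> xa sa us; apply: reach_last_passage us (notin_deep_hull xa sa).
exact: edge_deep_hull.
Qed.

Definition touching_prefix Y (l : seq {set V}) :=
  take (find (fun A : {set V} => [disjoint A & Y]) l) l.
Definition cov (l : seq {set V}) := [set v | has (fun A : {set V} => v \in A) l]%SET.
Definition ball C X d := [set u | `[< exists2 x, x \in X & reach C x d u >]]%SET.
Definition core i l := ball (hull i :\: cov l) (B i) delta.

(* [stk i] is the stack of cores active at bag [i]: [pre i] is the part inherited from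
   the parent bag, namely the longest prefix all of whose cores meet [B i], and the core
   [K i] is always pushed on top of it. The recursion is on the depth of [i]. *)
Fixpoint pref n i : seq {set V} :=
  if n is m.+1 then
    touching_prefix (B i) (rcons (pref m (par i)) (core (par i) (pref m (par i))))
  else [::].
Definition pre i := pref (dep i) i.
Definition K i := core i (pre i).
Definition stk i := rcons (pre i) (K i).
Definition D i := hull i :\: cov (pre i).
Definition lev i := size (pre i).

Lemma pre_root : pre root = [::].
Proof. by rewrite /pre dep_root. Qed.

Lemma preE i : i != root -> pre i = touching_prefix (B i) (stk (par i)).
Proof. by move=> h; rewrite /pre dep_par. Qed.

Lemma ballP C X d u :
  reflect (exists2 x, x \in X & reach C x d u) (u \in ball C X d).
Proof. by rewrite inE; apply: asboolP. Qed.

Lemma KP i u : reflect (exists2 x, x \in B i & reach (D i) x delta u) (u \in K i).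
Proof. exact: ballP. Qed.

Lemma K_D i u : u \in K i -> u \in D i.
Proof. by case/KP=> x _; apply: reach_r. Qed.

Lemma K_covN i u : u \in K i -> u \notin cov (pre i).
Proof. by move/K_D; rewrite inE => /andP[]. Qed.

Lemma mem_cov A l u : A \in l -> u \in A -> u \in cov l.
Proof. by move=> Al uA; rewrite inE; apply/hasP; exists A. Qed.

Lemma take_touching_prefix Y l n :
  n <= size (touching_prefix Y l) -> take n (touching_prefix Y l) = take n l.
Proof.
move=> h; rewrite /touching_prefix take_takel //; apply: leq_trans h _.
by rewrite size_take_min geq_minl.
Qed.

Lemma touching_prefixP Y l A : A \in touching_prefix Y l -> ~~ [disjoint A & Y].
Proof.
rewrite /touching_prefix; elim: l => //= A' l IH.
by case: ifP => //= h; rewrite inE => /predU1P[->|/IH //]; rewrite h.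
Qed.

Lemma touching_prefix_max Y l : size (touching_prefix Y l) < size l ->
  [disjoint nth finset.set0 l (size (touching_prefix Y l)) & Y].
Proof.
rewrite /touching_prefix; elim: l => //= A' l IH.
by case: ifP => //= h; rewrite ltnS => /IH.
Qed.

Lemma pre_touch i A : A \in pre i -> ~~ [disjoint A & B i].
Proof.
have [->|h] := eqVneq i root; first by rewrite pre_root.
by rewrite preE //; apply: touching_prefixP.
Qed.

Lemma pref_pairwise n i :
  pairwise (fun A A' : {set V} => [disjoint A & A']) (pref n i).
Proof.
elim: n i => //= n IH i.
apply: subseq_pairwise (take_subseq _ _) _; rewrite pairwise_rcons IH andbT.
apply/allP => A hA; apply/pred0P => u /=; apply/negP => /andP[uA].
case/ballP => x _ /reach_r; rewrite inE => /andP[/negP h _].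
by apply: h; apply: mem_cov uA.
Qed.

Lemma lev_le i : lev i <= k.
Proof.
apply: leq_trans _ (card_bag i).
by apply: size_touching_disjoint => [|A]; [apply: pref_pairwise|apply: pre_touch].
Qed.

Lemma size_stk i : size (stk i) = (lev i).+1.
Proof. by rewrite size_rcons. Qed.

Lemma take_stk i n : n <= lev i -> take n (stk i) = take n (pre i).
Proof. by move=> h; rewrite /stk -cats1 takel_cat. Qed.

Lemma take_pre_par i n : i != root -> n <= lev i -> take n (pre i) = take n (stk (par i)).
Proof. by move=> h; rewrite /lev preE // => /take_touching_prefix. Qed.

(** Bags only truncate the stack and push on top, so its first [n] cores can change only where the
    level drops below [n]. *)
Lemma take_pre_between a i n : sbelow i a -> n <= lev a ->
  (forall s, below i s -> sbelow s a -> n <= lev s) ->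
  take n (pre i) = take n (pre a).
Proof.
move=> ia na; move: i ia; apply: (sbelow_ind par_root dep_par) => i ia hp hs.
rewrite take_pre_par ?(sbelow_root par_root ia) ?hs ?below_refl //.
case: hp => [->|[pa IH]]; first exact: take_stk.
have hs' s : below (par i) s -> sbelow s a -> n <= lev s.
  by move=> h; apply: hs; apply: below_trans (below_par _ _) h.
by rewrite take_stk ?hs' ?below_refl // IH.
Qed.

(** [K a] has index [lev a] on its stack, so it survives while the levels stay strictly larger. *)
Lemma stk_kept a i : sbelow i a ->
  (forall s, below i s -> sbelow s a -> lev a < lev s) ->
  take (lev a).+1 (pre i) = stk a.
Proof.
move: i; apply: (sbelow_ind par_root dep_par) => i ia hp hs.
rewrite take_pre_par ?(sbelow_root par_root ia) ?hs ?below_refl //.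
case: hp => [->|[pa IH]]; first by rewrite take_oversize ?size_stk.
have hs' s : below (par i) s -> sbelow s a -> lev a < lev s.
  by move=> h; apply: hs; apply: below_trans (below_par _ _) h.
by rewrite take_stk ?hs' ?below_refl // IH.
Qed.

Lemma K_in_pre a i : sbelow i a ->
  (forall s, below i s -> sbelow s a -> lev a < lev s) -> K a \in pre i.
Proof.
move=> ia /(stk_kept ia) h; apply: (@mem_take (lev a).+1).
by rewrite h mem_rcons mem_head.
Qed.

(** By induction [K a] is on the parent's stack at index [lev a]; a cut exactly there would mean
    that [K a] misses the new bag. *)
Lemma lev_gt_while_touching a i : sbelow i a ->
  (forall s, below i s -> sbelow s a -> lev a <= lev s /\ ~~ [disjoint K a & B s]) ->
  forall s, below i s -> sbelow s a -> lev a < lev s.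
Proof.
move: i; apply: (sbelow_ind par_root dep_par) => i ia hp hs.
have iR := sbelow_root par_root ia.
have hsp : forall s, below (par i) s -> sbelow s a -> lev a < lev s.
  case: hp => [-> s as_ sa|[pa IH]]; first by case: (sbelowNbelow par_root dep_par sa as_).
  by apply: IH => // s h; apply: hs; apply: below_trans (below_par _ _) h.
have hK : take (lev a).+1 (stk (par i)) = stk a.
  case: hp => [->|[pa _]]; first by rewrite take_oversize ?size_stk.
  by rewrite take_stk ?hsp ?below_refl // stk_kept.
move=> s /below_inv[<- _|]; last exact: hsp.
have [le_ai touch] := hs i (below_refl _ _) ia.
rewrite ltn_neqAle le_ai andbT; apply: contra touch => /eqP eq_ai.
have hsz : lev a < size (stk (par i)).
  by have := congr1 size hK; rewrite size_stk size_take_min => <-; rewrite geq_minr.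
have := @touching_prefix_max (B i) (stk (par i)); rewrite -preE // -/(lev i) -eq_ai.
move/(_ hsz); rewrite -(nth_take _ (ltnSn (lev a))) hK.
by rewrite /stk nth_rcons ltnn eqxx.
Qed.

(** The core of the deepest bag of minimal level is not popped on the way to [i], and the cores
    under it come from [pre a] when [lev s <= lev a]. *)
Lemma last_min_lev a i : sbelow i a -> exists s,
  [/\ below i s, sbelow s a,
      forall s', below i s' -> sbelow s' a -> lev s <= lev s' &
      forall s', below i s' -> sbelow s' s -> lev s < lev s'].
Proof.
move: i; apply: (sbelow_ind par_root dep_par) => i ia [pa|[pa [s [h1 h2 h3 h4]]]].
  exists i; split=> //; first exact: below_refl.
    move=> s /below_inv[->//|]; rewrite pa => as_ sa.
    by case: (sbelowNbelow par_root dep_par sa as_).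
  by move=> s is_ si; case: (sbelowNbelow par_root dep_par si is_).
have [le_is|lt_si] := leqP (lev i) (lev s).
  exists i; split=> //; first exact: below_refl.
    move=> s' /below_inv[->//|ps' s'a]; exact: leq_trans le_is (h3 _ ps' s'a).
  by move=> s' is_ si; case: (sbelowNbelow par_root dep_par si is_).
exists s; split=> //; first exact: below_trans (below_par _ _) h1.
  by move=> s' /below_inv[<- _|]; [exact: ltnW|exact: h3].
by move=> s' /below_inv[<- //|]; apply: h4.
Qed.

(** While a core is on the stack, the cores under it do not change, so they are the ones removed in
    its own graph [D j]. *)
Lemma stk_nth i n : n < size (stk i) ->
  exists j, [/\ below i j, nth finset.set0 (stk i) n = K j & pre j = take n (stk i)].
Proof.
have [m] := ubnP (dep i); elim: m i => // m IH i hm.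
rewrite size_stk ltnS leq_eqVlt => /predU1P[->|hn].
  exists i; rewrite take_stk // take_size below_refl; split=> //.
  by rewrite /stk nth_rcons ltnn eqxx.
have iR : i != root by apply: contraTneq hn => ->; rewrite /lev pre_root.
have [||j [h1 h2 h3]] := IH (par i).
- by move: hm; rewrite (dep_par iR).
- move: hn; rewrite /lev preE // /touching_prefix size_take_min => h.
  exact: leq_trans h (geq_minr _ _).
exists j; split; first exact: below_trans (below_par _ _) h1.
  rewrite {1}/stk nth_rcons -/(lev i) hn -h2.
  by rewrite -(nth_take _ (ltnSn n) (pre i)) (take_pre_par iR hn) nth_take.
by rewrite h3 (take_stk (ltnW hn)) take_pre_par // ltnW.
Qed.

(** The walk is cut at its last visit to [B s]. All cores removed in [D s] are removed in [D t] too,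
    so the tail survives in [D s]. *)
Lemma reach_tail t s x u d : sbelow s t -> pre s = take (lev s) (pre t) ->
  x \in B t -> u \in hull s -> reach (D t) x d u ->
  exists z d1, [/\ z \in B s, reach (D t) x d1 z & reach (D s) z (d - d1)%R u].
Proof.
move=> /andP[st _] hs xt us.
case/(reach_through_bag xt st us) => z [d1 [zs h1 h2]].
exists z, d1; split=> //; apply: reach_sub h2 => //.
apply/fintype.subsetP => v; rewrite !inE => /andP[/andP[hv _] ->].
by rewrite andbT hs; apply: contra hv => /hasP[A /mem_take hA vA]; apply/hasP; exists A.
Qed.

Lemma pre_last_min i t s : sbelow i t -> below i s -> sbelow s t ->
  (forall s', below i s' -> sbelow s' t -> lev s <= lev s') -> lev s <= lev t ->
  pre s = take (lev s) (pre t).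
Proof.
move=> it is_ st hmin hst; rewrite -(take_pre_between st hst) ?take_size //.
by move=> s' ss' ; apply: hmin; apply: below_trans ss'.
Qed.

(* If [t1] had the smaller level, consider the last bag [s] of minimal level strictly
   below [t1]: if [K t1] is still on the stack, it is removed from [D t2]; otherwise the
   walk of length at most [delta] from [B t1] to [z] meets [B s], so that [z] lies in
   [K s], which is removed from [D t2]. *)
Lemma lev_lt_of_core z i t1 t2 : z \in hull i -> below i t2 -> sbelow t2 t1 ->
  z \in K t1 -> z \in K t2 -> lev t2 < lev t1.
Proof.
move=> zi it2 t21 z1 z2; rewrite ltnNge; apply/negP => le12.
have hz s : below t2 s -> z \in hull s.
  by move=> h; move/fintype.subsetP: (hull_mono (below_trans it2 h)); apply.
have notin A : A \in pre t2 -> z \in A -> False.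
  by move=> h1 h2; move/negP: (K_covN z2); apply; apply: mem_cov h2.
have [x xt hx] := KP _ _ z1.
have [s [h1 h2 h3 h4]] := last_min_lev t21.
have [lt1s|] := ltnP (lev t1) (lev s).
  apply: (notin (K t1)) z1; apply: K_in_pre => // s' a1 a2.
  exact: leq_trans lt1s (h3 _ a1 a2).
rewrite leq_eqVlt => /predU1P[eqs|lts].
  suff: lev t1 < lev s by rewrite eqs ltnn.
  apply: (lev_gt_while_touching t21) => // s' a1 a2; rewrite -{1}eqs h3 //; split=> //.
  have [y [d1 [ys hy hyz]]] := reach_through_bag xt (andP a2).1 (hz _ a1) hx.
  rewrite -setI_eq0; apply/set0Pn; exists y; rewrite inE ys andbT; apply/KP; exists x => //.
  by apply: reach_sub hy => //; have := reach_ge0 w_ge0 hyz; rewrite subr_ge0.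
have st2 : sbelow t2 s.
  by rewrite /sbelow h1; apply: contraTneq lts => <-; rewrite -leqNgt.
have [y [d1 [ys hy hyz]]] :=
  reach_tail h2 (pre_last_min t21 h1 h2 h3 (ltnW lts)) xt (hz _ h1) hx.
apply: (notin (K s)); first exact: K_in_pre.
apply/KP; exists y => //; apply: reach_sub hyz => //.
by rewrite gerBl (reach_ge0 w_ge0 hy).
Qed.

(** * Counting the bags that are close to a vertex *)

Lemma card_lev_inj (A : {set I}) :
  {in A &, forall i j, i != j -> lev i != lev j} -> #|A| <= k.+1.
Proof.
move=> h; pose f i : 'I_k.+1 := inord (lev i).
have fi : {in A &, injective f}.
  move=> i j iA jA /(congr1 val); rewrite /= !inordK ?ltnS ?lev_le // => eqij.
  by apply/eqP; apply: contraT => /(h _ _ iA jA); rewrite eqij eqxx.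
by rewrite -(card_in_imset fi) -[X in _ <= X]card_ord max_card.
Qed.

Definition core_bags z i := [set t | below i t && (z \in K t)]%SET.

Lemma core_bagsE z i t : (t \in core_bags z i) = below i t && (z \in K t).
Proof. by rewrite inE. Qed.

Lemma card_core_bags z i : z \in hull i -> #|core_bags z i| <= k.+1.
Proof.
move=> zi; apply: card_lev_inj => t1 t2; rewrite !core_bagsE => /andP[i1 z1] /andP[i2 z2] t12.
case: (below_total i1 i2) => h.
  by rewrite ltn_eqF // (lev_lt_of_core zi i1 _ z2 z1) // /sbelow h.
by rewrite gtn_eqF // (lev_lt_of_core zi i2 _ z1 z2) // /sbelow h eq_sym.
Qed.

Definition near_bags v := [set t | below (top v) t && (v \in ball (D t) (B t) rho)]%SET.
Definition outlying_bags v := [set t in near_bags v | v \notin K t]%SET.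

Lemma near_bagsE v t :
  (t \in near_bags v) = below (top v) t && (v \in ball (D t) (B t) rho).
Proof. by rewrite inE. Qed.

Lemma outlying_bagsE v t :
  (t \in outlying_bags v) = (t \in near_bags v) && (v \notin K t).
Proof. by rewrite inE. Qed.

(** The strict suffix minima of [lev] on the path from the root to [i]; the cores of these bags are
    on the stack [stk i]. *)
Definition records i :=
  [set s | below i s && [forall s', (below i s' && sbelow s' s) ==> (lev s < lev s')]]%SET.

Lemma recordsP i s : reflect
  (below i s /\ forall s', below i s' -> sbelow s' s -> lev s < lev s') (s \in records i).
Proof.
rewrite inE; apply: (iffP andP) => -[h1 h2]; split=> //.
  by move=> s' a1 a2; move/forallP/(_ s'): h2; rewrite a1 a2.
by apply/forallP => s'; apply/implyP => /andP[]; apply: h2.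
Qed.

Lemma card_records i : #|records i| <= k.+1.
Proof.
apply: card_lev_inj => s1 s2 /recordsP[i1 h1] /recordsP[i2 h2] s12.
case: (below_total i1 i2) => h.
  by rewrite gtn_eqF // h2 // /sbelow h.
by rewrite ltn_eqF // h1 // /sbelow h eq_sym.
Qed.

(* With [t0] the deepest outlying bag, the walk from any other outlying [t] meets [B s]
   at the last bag [s] of minimal level between [t] and [t0]. Its tail is longer than
   [delta] because [v] is not in [K s], so its head is at most [rho - delta <= delta]. *)
Lemma outlying_bags_sub v t0 : t0 \in outlying_bags v ->
  (forall t, t \in outlying_bags v -> dep t <= dep t0) ->
  outlying_bags v \subset
    records t0 :|: \bigcup_(s in records t0) \bigcup_(z in B s) core_bags z s.
Proof.
rewrite outlying_bagsE near_bagsE => /andP[/andP[vt0 v0D] t0K] deepest.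
apply/fintype.subsetP => t tO; move: (tO).
rewrite outlying_bagsE near_bagsE => /andP[/andP[vt /ballP[x xt hx]] tK].
have t0t : below t0 t := below_comparable par_root dep_par vt vt0 (deepest _ tO).
rewrite finset.in_setU; have [<-|neq] := eqVneq t0 t.
  by apply/orP; left; apply/recordsP; split=> [|s' a1 a2];
    [apply: below_refl|case: (sbelowNbelow par_root dep_par a2 a1)].
have st : sbelow t0 t by rewrite /sbelow t0t.
have [s [h1 h2 h3 h4]] := last_min_lev st.
have srec : s \in records t0 by apply/recordsP.
have [lts|les] := ltnP (lev t) (lev s).
  apply/orP; left; apply/recordsP; split=> // s' a1 a2.
  exact: leq_trans lts (h3 _ a1 a2).
apply/orP; right; apply/bigcupP; exists s => //.
have vs : v \in hull s by rewrite inE (below_trans vt0 h1).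
have [z [d1 [zs hz hzv]]] := reach_tail h2 (pre_last_min st h1 h2 h3 les) xt vs hx.
(* Either [s] is [t0], or [K s] is still on the stack at [t0] and hence removed from [D t0], which
   contains [v]. *)
have vKs : v \notin K s.
  have [<-//|ns] := eqVneq t0 s.
  have sp : K s \in pre t0 by apply: K_in_pre => //; rewrite /sbelow h1.
  case/ballP: v0D => x0 _ /reach_r; rewrite inE => /andP[+ _].
  by apply: contra => /(mem_cov sp).
apply/bigcupP; exists z => //; rewrite core_bagsE (andP h2).1; apply/KP; exists x => //.
apply: reach_sub hz => //; rewrite leNgt; apply/negP => ltd.
move/negP: vKs; apply; apply/KP; exists z => //; apply: reach_sub hzv => //.
by move: rho_le ltd; lra.
Qed.

(** The records, and for each record at most [k] vertices [z] of its bag with at most [k.+1] core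
    bags each. *)
Lemma card_outlying_bags v : #|outlying_bags v| <= k.+1 + k.+1 * (k * k.+1).
Proof.
have [->|[t ht]] := finset.set_0Vmem (outlying_bags v); first by rewrite cards0.
case: (arg_maxnP dep (P := mem (outlying_bags v)) ht) => t0 ht0 hmax.
apply: leq_trans (subset_leq_card (outlying_bags_sub ht0 hmax)) _.
apply: leq_trans (leq_card_setU _ _) (leq_add (card_records t0) _).
apply: leq_trans (card_bigcup_le (m := k * k.+1) _) _; last first.
  by rewrite leq_mul2r card_records orbT.
move=> s _; apply: leq_trans (card_bigcup_le (m := k.+1) _) _; last first.
  by rewrite leq_mul2r card_bag orbT.
by move=> z zs; apply: card_core_bags; rewrite inE zs orbT.
Qed.

Lemma card_near_bags v : #|near_bags v| <= k.+1 + (k.+1 + k.+1 * (k * k.+1)).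
Proof.
have h : near_bags v \subset core_bags v (top v) :|: outlying_bags v.
  apply/fintype.subsetP => t tn; rewrite finset.in_setU outlying_bagsE tn core_bagsE.
  by move: tn; rewrite near_bagsE => /andP[-> _]; case: (v \in K t).
apply: leq_trans (subset_leq_card h) _.
apply: leq_trans (leq_card_setU _ _) (leq_add _ (card_outlying_bags v)).
by apply: card_core_bags; rewrite inE below_refl.
Qed.

(** * Clusters: diameter, overlap and padding *)

Definition descendants y := [set u | below (top u) (top y)]%SET.

(* The union over all bags in which [y] serves as a center; a single cluster per
   center keeps the overlap bounded although [y] may lie in many bags. *)
Definition center_cluster y :=
  [set v | `[< exists2 t, y \in B t & reach (D t :&: descendants y) y rho v >]]%SET.

Lemma clusterP y v :
  reflect (exists2 t, y \in B t & reach (D t :&: descendants y) y rho v)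
          (v \in center_cluster y).
Proof. by rewrite inE; apply: asboolP. Qed.

(** The purpose of cutting clusters to [descendants y]: centers of clusters with a common vertex
    have comparable top bags. *)
Lemma cluster_below y v : v \in center_cluster y -> below (top v) (top y).
Proof. by case/clusterP=> t _ /reach_r; rewrite !inE => /andP[]. Qed.

(** Balls are connected inside themselves, so both vertices reach the center within the cluster,
    even if they stem from different bags [t]. *)
Lemma cluster_diam y u v : u \in center_cluster y -> v \in center_cluster y ->
  reach (center_cluster y) u (rho + rho)%R v.
Proof.
have H x : x \in center_cluster y -> reach (center_cluster y) y rho x.
  case/clusterP=> t yt /(reach_inside w_ge0); apply=> z hz.
  by apply/clusterP; exists t.
move=> /H hu /H hv; apply: reach_trans hv; exact: reach_sym.
Qed.

(** At most [k] centers in [B (top v)], and at most [k] in each near bag. *)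
Definition overlap_bound := k + (k.+1 + (k.+1 + k.+1 * (k * k.+1))) * k.

Lemma card_clusters_through v : #|[set y | v \in center_cluster y]%SET| <= overlap_bound.
Proof.
have h : [set y | v \in center_cluster y]%SET \subset B (top v) :|: \bigcup_(t in near_bags v) B t.
  apply/fintype.subsetP => y; rewrite inE => yv; rewrite finset.in_setU.
  have vy := cluster_below yv.
  have [t yt hr] := clusterP _ _ yv.
  have : v \in hull t by move/reach_r: hr; rewrite !inE => /andP[/andP[]].
  rewrite inE => /orP[vt|vt].
    apply/orP; right; apply/bigcupP; exists t => //; rewrite near_bagsE vt.
    by apply/ballP; exists y => //; apply: reach_sub hr => //; apply: subsetIl.
  (* Here [top v] lies between [t] and [top y], so convexity puts [y] into [B (top v)]. *)
  by rewrite (bag_convex yt (bag_below_top vt) vy).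
apply: leq_trans (subset_leq_card h) _.
apply: leq_trans (leq_card_setU _ _) (leq_add (card_bag _) _).
apply: leq_trans (card_bigcup_le (m := k) _) _; first by move=> t _.
by rewrite leq_mul2r card_near_bags orbT.
Qed.

Definition meet_clusters x y := ~~ [disjoint center_cluster x & center_cluster y].

Lemma card_earlier_neighbors y :
  #|[set x | [&& x != y, meet_clusters x y & dep (top x) <= dep (top y)]]%SET|
    <= k * overlap_bound.
Proof.
set N := [set x | _]%SET.
have h : N \subset \bigcup_(z in B (top y)) [set x | z \in center_cluster x]%SET.
  apply/fintype.subsetP => x; rewrite inE => /and3P[_ + dxy].
  rewrite /meet_clusters -setI_eq0 => /set0Pn[v /setIP[vx vy]].
  have yx := below_comparable par_root dep_par (cluster_below vx) (cluster_below vy) dxy.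
  have vhull : v \in hull (top y) by rewrite inE cluster_below.
  have [t xt hr] := clusterP _ _ vx.
  have [z [d1 [zy hz hzv]]] := reach_through_bag (top_in x) yx vhull hr.
  apply/bigcupP; exists z => //; rewrite inE; apply/clusterP; exists t => //.
  by apply: reach_sub hz => //; have := reach_ge0 w_ge0 hzv; rewrite subr_ge0.
apply: leq_trans (subset_leq_card h) _.
apply: leq_trans (card_bigcup_le (m := overlap_bound) _) _.
  by move=> z _; apply: card_clusters_through.
by rewrite leq_mul2r card_bag orbT.
Qed.

(* Adjacent vertices have comparable top bags. *)
Lemma reach_descendants C y d u : reach C y d u ->
  (forall x, x \in C -> dep (top y) <= dep (top x)) ->
  reach (C :&: descendants y) y d u.
Proof.
move=> [p hp hl] hC; exists p => //.
case/and3P: (hp) => h1 h2 /allP h3; apply/and3P; split=> //; apply/allP => a ap.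
rewrite inE h3 // inE.
have {}h3 : forall z, z \in p -> dep (top y) <= dep (top z).
  by move=> b bp; apply/hC/h3; rewrite inE bp orbT.
move: a ap; suff H : forall x, below (top x) (top y) -> path e x p ->
    forall z, z \in x :: p -> below (top z) (top y) by apply: H (below_refl _ _) h1.
elim: p h3 {hp hl h1 h2} => [|b p IH] h3 x xy /=.
  by move=> _ a; rewrite inE => /eqP ->.
move=> /andP[/bag_edge[c /andP[xc bc]] hp] a; rewrite inE => /predU1P[-> //|].
apply: IH hp a => [b' b'p|]; first by apply: h3; rewrite inE b'p orbT.
have cy := below_trans (bag_below_top xc) xy.
exact (below_comparable par_root dep_par cy (bag_below_top bc) (h3 b (mem_head b p))).
Qed.

Lemma ball_in_cluster v : (0 <= r)%R -> (delta + (r + r) <= rho)%R ->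
  exists y, forall u, reach [set: V] v r u -> u \in center_cluster y.
Proof.
move=> r0 hrho; pose Q := [set u | `[< reach [set: V] v r u >]]%SET.
have QP u : reflect (reach [set: V] v r u) (u \in Q) by rewrite inE; apply: asboolP.
have Qconn u : u \in Q -> reach Q v r u.
  by move/QP/(reach_inside w_ge0); apply=> z /QP.
have vQ : v \in Q by apply/QP/reach_refl; rewrite ?inE.
have QQ u u' : u \in Q -> u' \in Q -> reach Q u (r + r)%R u'.
  by move=> /Qconn hu /Qconn; apply: reach_trans; apply: reach_sym.
case: (arg_minnP (fun u => dep (top u)) (P := mem Q) vQ) => u0 u0Q u0min.
have {}u0Q : u0 \in Q by [].
set i := top u0; have Qi u : u \in Q -> below (top u) i.
  move=> /(QQ _ _ u0Q) /reach_descendants h.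
  by move/reach_r: (h u0min); rewrite !inE => /andP[].
have [n [hn nmin]] : exists n, has (fun u => u \in nth finset.set0 (stk i) n) (enum Q)
    /\ forall m, m < n -> ~~ has (fun u => u \in nth finset.set0 (stk i) m) (enum Q).
  have ex : exists n, has (fun u => u \in nth finset.set0 (stk i) n) (enum Q).
    (* A vertex of [B i] that avoids the kept cores lies in the new core [K i]. *)
    have u0i : u0 \in cov (stk i).
      rewrite /stk inE has_rcons; have [h|h] := boolP (u0 \in cov (pre i)).
        by move: h; rewrite inE => ->; rewrite orbT.
      apply/orP; left; apply/KP; exists u0; first exact: top_in.
      by apply: reach_refl => //; rewrite inE h inE top_in orbT.
    move: u0i; rewrite inE => /(has_nthP finset.set0)[n _ hn].
    by exists n; apply/hasP; exists u0; rewrite ?mem_enum.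
  case: (ex_minnP ex) => n hn nmin; exists n; split=> // m mn.
  by apply/negP => /nmin; rewrite leqNgt mn.
have [q] := hasP hn; rewrite mem_enum => qQ qn.
have nsz : n < size (stk i).
  by rewrite ltnNge; apply/negP => h; move: qn; rewrite nth_default // inE.
have [t [it hK hpre]] := stk_nth nsz.
have QD : Q \subset D t.
  apply/fintype.subsetP => u uQ; rewrite inE; apply/andP; split.
    rewrite hpre inE; apply/negP => /(has_nthP finset.set0)[m].
    rewrite size_take_min => hm; have mn : m < n := leq_trans hm (geq_minl _ _).
    rewrite nth_take // => um; move/negP: (nmin _ mn); apply.
    by apply/hasP; exists u; rewrite ?mem_enum.
  by rewrite inE (below_trans (Qi _ uQ) it).
move: qn; rewrite hK => /KP[x xt hx].
(* The walk from [x] may leave [descendants x], so the center is its vertex with the highest top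
   bag, which still lies in [B t]. *)
have [y [yx _ hy]] := reach_argmin w_ge0 (fun z => dep (top z)) hx.
have yD : y \in D t by move/reach_l: hy; rewrite inE => /andP[].
have ty : below t (top y).
  have := yD; rewrite inE => /andP[_]; rewrite inE => /orP[yt|/bag_below_top //].
  apply: (below_comparable par_root dep_par (below_refl _ _) yt).
  exact: leq_trans yx (below_dep par_root dep_par (bag_below_top xt)).
have yt : y \in B t.
  have := yD; rewrite inE => /andP[_]; rewrite inE => /orP[yt|//].
  by rewrite -(below_anti par_root dep_par yt ty) top_in.
have hyq : reach (D t :&: descendants y) y delta q.
  have hmin z : z \in [set z in D t | dep (top y) <= dep (top z)]%SET ->
    dep (top y) <= dep (top z) by rewrite inE => /andP[].
  apply: reach_sub (reach_descendants hy hmin) => //.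
  by apply/fintype.subsetP => a; rewrite !inE => /andP[/andP[-> _] ->].
exists y => u /QP uQ; apply/clusterP; exists t => //.
apply: reach_sub (reach_trans hyq (reach_sub _ (lexx _) (QQ _ _ qQ uQ))) => //.
apply/fintype.subsetP => a aQ; rewrite inE; move/fintype.subsetP: QD => -> //=.
by rewrite inE (below_trans (below_trans (Qi _ aQ) it) ty).
Qed.

End Clusters.

(** * Rooting the decomposition and assembling the partitions *)

(* Breadth-first search gives every non-root node a parent one level up; these
   [2 * (#|I| - 1)] ordered pairs already exhaust the edges, so there is no other edge. *)
Lemma tree_rooting (I : finType) (T : rel I) : is_tree T ->
  exists (root : I) (par : I -> I) (dep : I -> nat),
    [/\ par root = root, dep root = 0,
        forall i, i != root -> dep i = (dep (par i)).+1 &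
        forall i j, T i j -> i != root /\ j = par i \/ j != root /\ i = par j].
Proof.
case=> /card_gt0P[root _] _ Tsym Tconn Tcard.
have exd i : exists n, [exists p : n.-tuple I, path T root p && (last root p == i)].
  have /connectP[p hp ->] := Tconn root i.
  by exists (size p); apply/existsP; exists (in_tuple p); rewrite hp eqxx.
pose dep i := ex_minn (exd i).
have depP i : exists p, [/\ path T root p, last root p = i & size p = dep i].
  rewrite /dep; case: ex_minnP => n /existsP[p /andP[hp /eqP hl]] _.
  by exists p; rewrite size_tuple.
have dep_min p : path T root p -> dep (last root p) <= size p.
  move=> hp; rewrite /dep; case: ex_minnP => n _; apply.
  by apply/existsP; exists (in_tuple p); rewrite hp eqxx.
have dep0 : dep root = 0 by apply/eqP; rewrite -leqn0 (dep_min [::]).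
have up i : i != root -> exists j, T j i && (dep i == (dep j).+1).
  move=> iR; have [p [hp hl hs]] := depP i.
  case: (lastP p) hp hl hs => [_ /= h|q j]; first by rewrite h eqxx in iR.
  rewrite rcons_path last_rcons size_rcons => /andP[hq hj] ji hs; rewrite -{}ji in hs *.
  exists (last root q); rewrite hj eqn_leq -{2}hs ltnS dep_min // andbT.
  have [q' [hq' hl' hs']] := depP (last root q).
  by rewrite -hs' -(size_rcons q' j) -{1}(last_rcons root q' j) dep_min // rcons_path hq' hl'.
pose par i := if i == root then root else odflt root [pick j | T j i && (dep i == (dep j).+1)].
have parP i : i != root -> T (par i) i && (dep i == (dep (par i)).+1).
  move=> iR; rewrite /par (negPf iR); case: pickP => //= h.
  by have [j] := up i iR; rewrite h.
exists root, par, dep; split=> // [|i /parP/andP[_ /eqP //]|]; first by rewrite /par eqxx.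
pose E1 := [set (i, par i) | i in [set~ root]]%SET.
pose E2 := [set (par i, i) | i in [set~ root]]%SET.
have disjE : (E1 :&: E2 = finset.set0)%SET.
  apply/setP => -[a b]; rewrite !inE; apply/negP => /andP[/imsetP[i] + [-> ->]].
  rewrite !inE => /parP/andP[_ /eqP di] /imsetP[j]; rewrite !inE.
  by move=> /parP/andP[_ /eqP dj] [ij ji]; move: di dj; rewrite ji -ij; lia.
have eqE : (E1 :|: E2 = [set q : I * I | T q.1 q.2])%SET.
  apply/eqP; rewrite eqEcard Tcard cardsU disjE cards0 subn0; apply/andP; split.
    apply/fintype.subsetP => q; rewrite !inE => /orP[] /imsetP[i];
      rewrite !inE => /parP/andP[h _] -> //=; by rewrite Tsym.
  rewrite !card_imset => [|i j [//]|i j [//]].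
  by rewrite cardsC1 subn1 mul2n addnn.
move=> i j Tij; have : (i, j) \in (E1 :|: E2)%SET by rewrite eqE inE.
rewrite inE => /orP[] /imsetP[a]; rewrite !inE => aR [-> ->]; [left|right]; by [].
Qed.

Lemma td_rooting (V : finType) (e : rel V) (I : finType) (T : rel I) (B : I -> {set V}) :
  is_tree_decomposition e T B ->
  exists (root : I) (par : I -> I) (dep : I -> nat) (top : V -> I),
    [/\ par root = root, dep root = 0 &
        forall i, i != root -> dep i = (dep (par i)).+1] /\
    [/\ forall v, v \in B (top v),
        forall v c, v \in B c -> below par c (top v) &
        forall v c i, v \in B c -> below par c i -> below par i (top v) -> v \in B i].
Proof.
case=> /tree_rooting[root [par [dep [par_root dep_root dep_par edges]]]] cover _ conn.
have /choice[top topP] v : exists t, v \in B t /\ forall c, v \in B c -> dep t <= dep c.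
  have [i vi] := cover v; case: (arg_minnP dep (P := fun c => v \in B c) vi) => t.
  by exists t.
(* A path through bags of [v] that leaves the subtree of [i] uses the edge from [i] to [par i]. *)
have exit v c a i : v \in B c -> v \in B a -> below par c i -> ~ below par a i ->
    [/\ v \in B i, v \in B (par i) & i != root].
  move=> vc va + na; have /connectP[p hp ha] := conn v c a vc va.
  elim: p c hp ha {vc} => [|b p IH] c /= => [_ <- //|/andP[/and3P[cb vc vb] hp] ha ci].
  have [bi|nb] := boolP (below par b i); first exact: IH hp ha bi.
  case: (edges _ _ cb) => -[h1 h2].
    case: (below_inv ci) => [<-|]; first by rewrite -h2.
    by rewrite -h2 (negPf nb).
  by move: nb; rewrite (below_trans (below_par par b)) // -h2.
have le_top v c : v \in B c -> below par c (top v).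
  move=> vc; apply: contraT => /negP nc.
  have [vt tmin] := topP v.
  have [_ vp tR] := exit v _ _ _ vt vc (below_refl _ _) nc.
  by have := tmin _ vp; rewrite (dep_par _ tR) ltnn.
exists root, par, dep, top; split=> //; split=> //; first by move=> v; case: (topP v).
move=> v c i vc ci it; have [vt _] := topP v.
have [ti|nti] := boolP (below par (top v) i).
  by rewrite (below_anti par_root dep_par it ti).
by case: (exit v c (top v) i vc vt ci (negP nti)).
Qed.

(** Uncovered vertices become singletons. Blocks are nonempty, hence the point [x] in the last
    clause. *)
Lemma partition_of_disjoint_family (V J : finType) (F : J -> {set V}) (A : pred J) :
  {in A &, forall i j, i != j -> [disjoint F i & F j]} ->
  exists P : {set {set V}},
    [/\ finset.partition P [set: V],
        forall C, C \in P -> (exists j, C = F j) \/ (exists x, C = [set x]%SET) &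
        forall j x, j \in A -> x \in F j -> F j \in P].
Proof.
move=> disj.
pose f u : J + V := if [pick j | (j \in A) && (u \in F j)] is Some j then inl j else inr u.
have fl j u : j \in A -> (f u == inl j) = (u \in F j).
  move=> jA; rewrite /f; case: pickP => [i /andP[iA ui]|h]; last by have := h j; rewrite jA /=.
  rewrite (inj_eq (@inl_inj _ _)); have [<-|ij] := eqVneq i j; first by rewrite ui.
  by rewrite (disjointFr (disj _ _ iA jA ij) ui).
have fr u x : f u = inr x -> u = x by rewrite /f; case: pickP => // _ [].
have blk x : [set u in [set: V] | f x == f u]%SET \in preim_partition f [set: V]%SET.
  by apply/imsetP; exists x.
exists (preim_partition f [set: V]); split; first exact: preim_partitionP.
  move=> C /imsetP[x _ ->]; case fx: (f x) => [j|y].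
    have jA : j \in A.
      by move: fx; rewrite /f; case: pickP => // i /andP[iA _] [<-].
    by left; exists j; apply/setP => u; rewrite !inE /= eq_sym fl.
  have xy := fr _ _ fx; right; exists x; apply/setP => u; rewrite !inE /=.
  apply/eqP/eqP => [/esym/fr ->|-> //]; by rewrite -xy.
move=> j x jA xj; have /eqP fx : f x == inl j by rewrite fl.
suff -> : F j = [set u in [set: V] | f x == f u]%SET by apply: blk.
by apply/setP => u; rewrite !inE /= fx eq_sym fl.
Qed.

Lemma overlap_bound_poly n : 0 < n -> (n * overlap_bound n).+1 <= 10 * n ^ 5.
Proof.
move=> n0; have le a : a <= 5 -> n ^ a <= n ^ 5 by apply: leq_pexp2l.
(* The coefficients sum to 10. *)
have -> : (n * overlap_bound n).+1 = n ^ 5 + 2 * n ^ 4 + 3 * n ^ 3 + 3 * n ^ 2 + 1.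
  by rewrite /overlap_bound; ring.
have := (le 4 isT, le 3 isT, le 2 isT, le 0 isT); rewrite expn0.
by move=> [[[]]]; lia.
Qed.

Lemma dist_in_le (R : realType) (V : finType) (e : rel V) (w : V -> V -> R)
    (C : {set V}) u d v : reach e w C u d v -> (dist_in e w C u v <= d%:E)%E.
Proof.
case=> p hp hl; apply: (@le_trans _ _ (walk_len w u p)%:E); last by rewrite lee_fin.
by apply: ereal_inf_lbound; exists p.
Qed.

(** A strict bound on an infimum yields a walk. To gain strictness, balls of radius [Delta / 16] are
    padded with [r = Delta / 8]. *)
Lemma dist_lt_reach (R : realType) (V : finType) (e : rel V) (w : V -> V -> R)
    u d v : (dist e w u v < d%:E)%E -> reach e w [set: V] u d v.
Proof.
case/ereal_inf_lt=> _ [p hp ->]; rewrite lte_fin => /ltW hl.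
by exists p.
Qed.

Theorem theorem1p4 (R : realType) :
  exists (beta c K : R), [/\ (1 <= beta)%R, (0 < c)%R, (0 < K)%R &
    forall (V : finType) (e : rel V) (w : V -> V -> R) (tw : nat),
      wgraph e w -> gconnected e -> is_treewidth e tw ->
      forall Delta : R, (0 < Delta)%R ->
        exists Ps : seq {set {set V}},
          [/\ ((size Ps)%:R <= K * powR (tw.+1)%:R c)%R,
              (forall P, P \in Ps -> finset.partition P [set: V]),
              (forall P C, P \in Ps -> C \in P ->
                 forall u v, u \in C -> v \in C -> (dist_in e w C u v <= Delta%:E)%E) &
              (forall x : V, exists2 P, P \in Ps &
                 exists2 C, C \in P & ball_G e w x (Delta / beta) \subset C)]].
Proof.
exists 16%:R%R, 5%:R%R, 10%:R%R; split; rewrite ?ler1n ?ltr0n // => V e w tw.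
move=> [_ e_sym w_sym w_ge0] _ [[I [T [B [td htw]]]] _] Delta Delta0.
have [root [par [dep [top [[par_root dep_root dep_par] [top_in top_le convex]]]]]] :=
  td_rooting td.
case: td => _ _ bag_edge _.
have card_bag i : #|B i| <= tw.+1.
  rewrite -htw; apply: leq_trans (leqSpred _).
  exact: (leq_bigmax (F := fun i => #|B i|)).
(* Forced by diameter [rho + rho = Delta] and equality in [rho_le] and [hrho]. *)
pose delta := (Delta / 4)%R; pose rho := (Delta / 2)%R; pose r := (Delta / 8)%R.
have delta0 : (0 <= delta)%R by rewrite /delta; lra.
have r0 : (0 <= r)%R by rewrite /r; lra.
have rho_le : (rho <= delta + delta)%R by rewrite /rho /delta; lra.
have hrho : (delta + (r + r) <= rho)%R by rewrite /rho /delta /r; lra.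
pose cl := center_cluster e w par dep B top delta rho.
have cl_sym : symmetric (meet_clusters e w par dep B top delta rho).
  by move=> x y; rewrite /meet_clusters disjoint_sym.
have [col hcol] := greedy_coloring cl_sym
  (card_earlier_neighbors w_ge0 par_root dep_root dep_par top_in top_le convex bag_edge
     rho_le card_bag).
have cl_disj c : {in [pred y | col y == c] &, forall x y, x != y -> [disjoint cl x & cl y]}.
  move=> x y /eqP xc /eqP yc xy; apply: contraT => /(hcol _ _ xy).
  by rewrite xc yc eqxx.
have /choice[P hP] := fun c => partition_of_disjoint_family (@cl_disj c).
exists [seq P c | c <- enum 'I_(tw.+1 * overlap_bound tw.+1).+1]; split.
- rewrite size_map -cardE card_ord powR_mulrn ?ler0n // -natrX -natrM ler_nat.
  exact: overlap_bound_poly.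
- by move=> _ /mapP[c _ ->]; case: (hP c).
- move=> _ C /mapP[c _ ->]; have [_ hC _] := hP c => /hC[[y ->]|[x ->]] u v.
    move=> uy vy; have -> : Delta = (rho + rho)%R by rewrite /rho; lra.
    exact/dist_in_le/(cluster_diam e_sym w_sym w_ge0).
  rewrite !inE => /eqP -> /eqP ->; apply: dist_in_le.
  by apply: reach_refl; rewrite ?inE // ltW.
move=> x; have [y hy] := ball_in_cluster e_sym w_sym w_ge0 par_root dep_root dep_par
  top_in top_le bag_edge delta0 x r0 hrho.
exists (P (col y)); first by rewrite map_f ?mem_enum.
have [_ _ hin] := hP (col y).
exists (cl y).
  by apply: (hin y x); [rewrite inE|apply/hy/reach_refl; rewrite ?inE].
apply/fintype.subsetP => u; rewrite inE => hu; apply/hy/dist_lt_reach.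
by apply: le_lt_trans hu _; rewrite lte_fin /r; lra.
Qed.
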